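(* Let $l,k\ge 1$ be integers and let $a\times A$, $b\times B$ and $c\times C$ be rectangular Young diagrams contained in $l\times k$ (so $0\le a,b,c\le l$ and $0\le A,B,C\le k$). Then the following are equivalent: (I) there exist Young diagrams $\lambda,\mu,\nu\subseteq l\times k$ containing $a\times A$, $b\times B$ and $c\times C$, respectively, such that $\sigma_\lambda\cdot\sigma_\mu\cdot\sigma_\nu\neq 0$; (II) $\sigma_{a\times A}\cdot\sigma_{b\times B}\cdot\sigma_{c\times C}\neq 0$; (III) all of the following five conditions hold: (i) $a+b\le l$ or $A+B\le k$; (ii) $a+c\le l$ or $A+C\le k$; (iii) $b+c\le l$ or $B+C\le k$; (iv) $a+b+c\le l$ or $A+B+C\le 2k$; (v) $a+b+c\le 2l$ or $A+B+C\le k$. Here the products are taken in the classical cohomology ring $\mathrm{H}^*(Gr(l,\mathbb{C}^{l+k}),\mathbb{Z})$.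
   Context: Partitions are identified with their Young diagrams. $a\times A$ denotes the rectangular Young diagram with $a$ rows and $A$ columns; $\lambda\subseteq l\times k$ means that $\lambda$ has at most $l$ rows and $\lambda_1\le k$. The classical cohomology ring $\mathrm{H}^*(Gr(l,\mathbb{C}^{l+k}),\mathbb{Z})$ of the Grassmannian of $l$-dimensional subspaces of $\mathbb{C}^{l+k}$ has an additive basis of Schubert classes $\{\sigma_\lambda\}_{\lambda\subseteq l\times k}$, with product $\sigma_\lambda\cdot\sigma_\mu=\sum_{\nu\subseteq l\times k}c_{\lambda,\mu}^{\nu}\sigma_\nu$, where $c_{\lambda,\mu}^\nu$ is the Littlewood-Richardson coefficient. *)

(* Defs.v *)
From HB Require Import structures.
From mathcomp Require Import all_boot all_order all_algebra.

Set Implicit Arguments.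
Unset Strict Implicit.
Unset Printing Implicit Defensive.

Import GRing.Theory.

(* A Young diagram contained in the rectangle l x k (l rows, k columns) is the
   weakly decreasing sequence of its l row lengths, zeros included. *)
Definition is_young (l k : nat) (f : {ffun 'I_l -> 'I_k.+1}) : bool :=
  [forall i : 'I_l, forall j : 'I_l, (i <= j) ==> (f j <= f i)].

Record young (l k : nat) := Young {
  young_row :> {ffun 'I_l -> 'I_k.+1};
  young_rowP : is_young young_row }.

HB.instance Definition _ l k := [isSub for @young_row l k].
HB.instance Definition _ l k := [Finite of young l k by <:].

Definition young_sub (l k : nat) (p q : young l k) : bool :=
  [forall i : 'I_l, p i <= q i].

Definition rect_row (l k : nat) (a : 'I_l.+1) (A : 'I_k.+1) :
    {ffun 'I_l -> 'I_k.+1} :=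
  [ffun i : 'I_l => if i < a then A else ord0].

Lemma rect_rowP (l k : nat) (a : 'I_l.+1) (A : 'I_k.+1) :
  is_young (rect_row a A).
Proof.
apply/forallP => i; apply/forallP => j; apply/implyP => ij.
rewrite !ffunE; case: (ltnP j a) => // ja.
by rewrite (leq_ltn_trans ij ja).
Qed.

Definition rect (l k : nat) (a : 'I_l.+1) (A : 'I_k.+1) : young l k :=
  Young (rect_rowP a A).

(* Boxes are pairs (row, column), both counted from 0. *)
Definition skew_box (l k : nat) (lam nu : young l k) (x : 'I_l * 'I_k) : bool :=
  lam x.1 <= x.2 < nu x.1.

(* y is read no later than x when the rows are read from top to bottom, each
   of them from right to left. *)
Definition read_upto (l k : nat) (x y : 'I_l * 'I_k) : bool :=
  (y.1 < x.1) || (y.1 == x.1) && (x.2 <= y.2).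

(* T is a Littlewood-Richardson tableau of shape nu / lam and content mu.  The
   letters are 1, ..., l, which suffices as mu has at most l rows, and the
   value 0 marks the boxes outside nu / lam.  As rows of mu are counted from 0,
   the letter m.+1 occurs mu m times. *)
Definition lr_tableau (l k : nat) (lam mu nu : young l k)
    (T : {ffun 'I_l * 'I_k -> 'I_l.+1}) : bool :=
  [&& young_sub lam nu,
      [forall x, (0 < T x) == skew_box lam nu x],
      [forall x, forall y,
        [&& skew_box lam nu x, skew_box lam nu y, x.1 == y.1 & x.2 <= y.2]
          ==> (T x <= T y)],
      [forall x, forall y,
        [&& skew_box lam nu x, skew_box lam nu y, x.2 == y.2 & x.1 < y.1]
          ==> (T x < T y)],
      [forall m : 'I_l, #|[set x | T x == m.+1 :> nat]| == mu m]
    & [forall x, forall m : 'I_l,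
        (0 < m) ==>
        (#|[set y | read_upto x y & T y == m.+1 :> nat]|
           <= #|[set y | read_upto x y & T y == m :> nat]|)]].

Definition lr_coef (l k : nat) (lam mu nu : young l k) : nat :=
  #|[set T | lr_tableau lam mu nu T]|.

(* H^*(Gr(l, C^(l+k)), Z) in its Schubert basis: the free Z-module on the Young
   diagrams contained in l x k.  Its product is cup below, not the pointwise
   product of functions, which is what the ring notation x * y denotes here. *)
Notation coh l k := {ffun young l k -> int}.

Definition schubert (l k : nat) (lam : young l k) : coh l k :=
  [ffun p => (p == lam)%:R%R].

Definition cup (l k : nat) (x y : coh l k) : coh l k :=
  (\sum_(lam : young l k) \sum_(mu : young l k) \sum_(nu : young l k)
     schubert nu *~ (x lam * y mu * (lr_coef lam mu nu)%:R))%R.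

Lemma cup_schubert (l k : nat) (lam mu : young l k) :
  cup (schubert lam) (schubert mu)
  = (\sum_(nu : young l k) schubert nu *+ lr_coef lam mu nu)%R.
Proof.
rewrite /cup (bigD1 lam) //= [X in (_ + X)%R]big1 ?addr0 => [|p pl]; last first.
  rewrite big1 // => q _; rewrite big1 // => nu _.
  by rewrite ffunE (negbTE pl) !mul0r mulr0z.
rewrite (bigD1 mu) //= [X in (_ + X)%R]big1 ?addr0 => [|q qm]; last first.
  by rewrite big1 // => nu _; rewrite !ffunE (negbTE qm) mulr0 mul0r mulr0z.
by apply: eq_bigr => nu _; rewrite !ffunE !eqxx !mul1r natz -pmulrn.
Qed.

(* Main.v *)
(* Littlewood-Richardson coefficients are nonnegative, so a triple product is
   nonzero as soon as one chain lam -> rho -> p of nonzero coefficients exists.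

   Necessity.  The lattice condition shows that the letter v+1 occurs in the
   first i+1 rows at most as often as v in the first i rows.  Iterating this and
   counting columns gives, with rows counted from 0,
     lam_i + mu_j <= nu_(i+j+1-l)    and    lam_i + mu_j <= k + nu_(i+j+1).
   Hence nu contains the rectangles (a+b-l) x (A+B) and (a+b) x (A+B-k), and the
   five conditions follow by applying this twice.

   Sufficiency.  The last factor c x C can be multiplied onto rho as soon as rho
   avoids the c x C corner opposite to the origin: add c boxes to each of the
   last C columns of rho and sort the columns.  For the first product, the same
   recipe gives a rho avoiding the corner unless a+c > l and b+c > l; in that case
   take the rho obtained by adding B boxes to each of the last b rows of a
   diagram a x A with a+b-t rows, t = max(a+b-l, 0), and sorting the rows. *)
Require Import Defs.
From mathcomp Require Import all_boot all_order all_algebra.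
From mathcomp Require Import zify.

Set Implicit Arguments.
Unset Strict Implicit.
Unset Printing Implicit Defensive.

Import GRing.Theory Num.Theory.

(** * Coefficients of triple products *)

Lemma card_ord_interval k u v :
  v <= k -> #|[set j : 'I_k | u <= j < v]| = v - u.
Proof.
move=> vk; rewrite -[RHS]muln1 -sum_nat_const_nat (big_nat_widen _ _ k) //.
rewrite (big_nat_widenl _ 0) // big_mkord -sum1dep_card.
by apply: eq_bigl => j; rewrite andbC.
Qed.

Lemma cup_schubert_coef l k (lam mu nu p : young l k) :
  cup (cup (schubert lam) (schubert mu)) (schubert nu) p
  = (\sum_(rho : young l k) lr_coef lam mu rho * lr_coef rho nu p)%N%:R%R.
Proof.
have cupE (x y : coh l k) q : cup x y q =
    (\sum_lam \sum_mu x lam * y mu * (lr_coef lam mu q)%:R)%R.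
  rewrite /cup sum_ffunE; apply: eq_bigr => r _.
  rewrite sum_ffunE; apply: eq_bigr => s _.
  rewrite sum_ffunE (bigD1 q) //= big1 ?addr0 => [|z zq].
    by rewrite ffunMzE ffunE eqxx intz.
  by rewrite ffunMzE ffunE eq_sym (negbTE zq) mul0rz.
rewrite cupE natr_sum; apply: eq_bigr => rho _.
rewrite (bigD1 nu) //= big1 ?addr0 => [|s sn]; last first.
  by rewrite [schubert nu s]ffunE (negbTE sn) mulr0 mul0r.
rewrite cup_schubert sum_ffunE (bigD1 rho) //= big1 ?addr0 => [|s sr]; last first.
  by rewrite ffunMnE ffunE eq_sym (negbTE sr) mul0rn.
by rewrite ffunMnE !ffunE !eqxx mulr1 natrM.
Qed.

Lemma cup3_neq0P l k (lam mu nu : young l k) :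
  cup (cup (schubert lam) (schubert mu)) (schubert nu) <> 0%R <->
  exists rho p, 0 < lr_coef lam mu rho /\ 0 < lr_coef rho nu p.
Proof.
split=> [nz | [rho [p [c1 c2]]] /ffunP/(_ p)].
  pose coef p := \sum_(rho : young l k) lr_coef lam mu rho * lr_coef rho nu p.
  case: (pickP (fun p => 0 < coef p)).
    move=> p; rewrite /coef lt0n sum_nat_eq0 => /forallPn[rho /=].
    by rewrite -lt0n muln_gt0 => /andP[]; exists rho, p.
  move=> z; case: nz; apply/ffunP=> p; rewrite cup_schubert_coef ffunE.
  by move/negbT: (z p); rewrite -eqn0Ngt /coef => /eqP->.
rewrite cup_schubert_coef ffunE => /eqP; rewrite pnatr_eq0 (bigD1 rho) //=.
by rewrite addn_eq0 muln_eq0 !eqn0Ngt c1 c2.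
Qed.

(** * Letter counts and row inequalities for Littlewood-Richardson tableaux *)

Lemma youngP l k (p : young l k) (i j : 'I_l) : i <= j -> p j <= p i.
Proof.
move=> ij; have /forallP/(_ i)/forallP/(_ j)/implyP := young_rowP p; exact.
Qed.

Definition rows_count l k (T : {ffun 'I_l * 'I_k -> 'I_l.+1}) (v i : nat) : nat :=
  #|[set y : 'I_l * 'I_k | (y.1 < i) && (T y == v :> nat)]|.

Lemma lr_tableau_box l k (lam mu nu : young l k) T y :
  lr_tableau lam mu nu T -> 0 < T y -> lam y.1 <= y.2 < nu y.1.
Proof. by case/and5P=> _ /forallP/(_ y)/eqP-> _ _ _. Qed.

Lemma lr_tableau_content l k (lam mu nu : young l k) T (m : 'I_l) :
  lr_tableau lam mu nu T -> rows_count T m.+1 l = mu m.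
Proof.
case/and5P=> _ _ _ _ /andP[/forallP/(_ m)/eqP<- _]; apply: eq_card => y.
by rewrite !inE ltn_ord.
Qed.

(* By column strictness the boxes of a given letter lie in distinct columns. *)
Lemma lr_tableau_card_cols l k (lam mu nu : young l k) T v (P : pred 'I_l) lo hi :
  lr_tableau lam mu nu T -> 0 < v -> hi <= k ->
  (forall i, P i -> lo <= lam i) -> (forall i, P i -> nu i <= hi) ->
  #|[set y : 'I_l * 'I_k | P y.1 && (T y == v :> nat)]| <= hi - lo.
Proof.
move=> lrT v0 hk Plo Phi; rewrite -(card_ord_interval lo hk).
have inj : {in [set y | P y.1 && (T y == v :> nat)] &, injective (@snd 'I_l 'I_k)}.
  have lt_absurd y z : T y = v :> nat -> T z = v :> nat -> y.2 = z.2 -> ~~ (y.1 < z.1).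
    move=> Ty Tz yz; apply/negP=> lt_yz.
    have /and5P[_ /forallP box _ /forallP/(_ y)/forallP/(_ z)/implyP col _] := lrT.
    suff: T y < T z by rewrite Ty Tz ltnn.
    by apply: col; rewrite -(eqP (box y)) -(eqP (box z)) Ty Tz v0 yz eqxx lt_yz.
  move=> [i j] [i' j']; rewrite !inE /= => /andP[_ /eqP Ty] /andP[_ /eqP Tz] jj.
  suff ii : i = i' by rewrite ii jj.
  apply: ord_inj; have := lt_absurd _ _ Tz Ty (esym jj); have := lt_absurd _ _ Ty Tz jj.
  by case: ltngtP.
rewrite -(card_in_imset inj); apply/subset_leq_card/subsetP=> j.
case/imsetP=> y; rewrite !inE => /andP[Py /eqP Ty] ->.
have /andP[lo_y y_hi] : lam y.1 <= y.2 < nu y.1.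
  by apply: (lr_tableau_box lrT); rewrite Ty.
by rewrite (leq_trans (Plo _ Py)) // (leq_trans y_hi) // Phi.
Qed.

(** Apply the lattice condition at the last read of these letters [v.+1], say in row [r]. The
    letters [v] read up to there lie strictly above row [r], since a weakly increasing row has no
    [v] to the right of a [v.+1]. *)
Lemma lr_tableau_rows_countS l k (lam mu nu : young l k) T v i :
  lr_tableau lam mu nu T -> 0 < v < l ->
  rows_count T v.+1 i.+1 <= rows_count T v i.
Proof.
move=> lrT /andP[v0 vl]; rewrite /rows_count; set X := [set y | _].
have [->|/set0Pn[y0 Xy0]] := eqVneq X set0; first by rewrite cards0.
(* [pos] grows along the reading order: [k - y.2] lies between 1 and [k], so rows are compared
   first. *)
pose pos (y : 'I_l * 'I_k) := y.1 * k + (k - y.2).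
have [[r c] Xx xmax] := arg_maxnP (P := mem X) pos Xy0.
have /and5P[_ /forallP box /forallP row _ /andP[_ lattice]] := lrT.
have /forallP/(_ (r, c))/forallP/(_ (Ordinal vl))/implyP/(_ v0) := lattice.
have: (r, c) \in X by exact: Xx.
rewrite inE => /andP[/= ri /eqP Trc].
move=> le_rc; apply: leq_trans (leq_trans _ le_rc) _;
  apply/subset_leq_card/subsetP => -[r' c'].
  move=> Xy; have {xmax} := xmax _ Xy; move: Xy; rewrite !inE => /andP[_ ->].
  rewrite andbT /pos /read_upto -val_eqE /= => le_pos; case: (ltngtP r' r) => //= rr.
    have: r.+1 * k <= r' * k by rewrite leq_mul2r rr orbT.
    by have := ltn_ord c'; rewrite mulSn; lia.
  by move: le_pos; rewrite rr; have := ltn_ord c'; have := ltn_ord c; lia.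
rewrite !inE /= => /andP[+ /eqP Ty].
rewrite Ty eqxx andbT /read_upto /= => /orP[|/andP[/eqP rr le_cc]].
  by move=> rr; apply: leq_trans rr _.
have: T (r, c) <= T (r', c').
  have /forallP/(_ (r', c'))/implyP := row (r, c); apply.
  by rewrite -(eqP (box (r, c))) -(eqP (box (r', c'))) Trc Ty v0 /= rr eqxx.
by rewrite Trc Ty ltnn.
Qed.

Lemma lr_tableau_rows_countD l k (lam mu nu : young l k) T v i d :
  lr_tableau lam mu nu T -> 0 < v -> v + d <= l ->
  rows_count T (v + d) (i + d) <= rows_count T v i.
Proof.
move=> lrT v0; elim: d => [|d IHd] vdl; first by rewrite !addn0.
rewrite !addnS (leq_trans (lr_tableau_rows_countS _ lrT _)) ?IHd //; lia.
Qed.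

(** Shift down to the letter 1: the letters [s.+1] in the first [s] rows are at most as many as the
    letters 1 in the first 0 rows. *)
Lemma lr_tableau_row_ge l k (lam mu nu : young l k) T y :
  lr_tableau lam mu nu T -> T y <= y.1.+1.
Proof.
move=> lrT; case Ty: (T y : nat) => [//|s]; rewrite ltnS leqNgt; apply/negP => lt_y.
have := @lr_tableau_rows_countD _ _ _ _ _ T 1 0 s lrT isT.
have := ltn_ord (T y); rewrite Ty add1n add0n => /ltnSE sl /(_ sl).
rewrite [X in _ <= X]eq_card0 => [|z]; last by rewrite inE ltn0.
by rewrite leqn0 cards_eq0 => /eqP/setP/(_ y); rewrite !inE lt_y Ty eqxx.
Qed.

(** Shifting by [l - i.+1] bounds the [mu j] letters [j.+1] by the letters [r.+1] in rows up to [i].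
    These lie in rows [r] to [i], hence in distinct columns between [lam i] and [nu r]. *)
Lemma lr_row_ge_add l k (lam mu nu : young l k) (i j r : 'I_l) :
  0 < lr_coef lam mu nu -> i + j + 1 = r + l -> lam i + mu j <= nu r.
Proof.
case/card_gt0P=> T; rewrite inE => lrT eq_r.
have lt_il := ltn_ord i; have lt_jl := ltn_ord j; have lt_rl := ltn_ord r.
have le_lam : lam i <= nu r.
  have /and5P[/forallP/(_ i) sub _ _ _ _] := lrT.
  by apply: leq_trans sub (youngP _ _); lia.
suff: mu j <= nu r - lam i by lia.
rewrite -(lr_tableau_content j lrT).
have -> : j.+1 = r.+1 + (l - i.+1) by lia.
rewrite [X in rows_count _ _ X](_ : _ = i.+1 + (l - i.+1)); last by lia.
apply: leq_trans (lr_tableau_rows_countD _ lrT _ _) _ => //; first by lia.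
pose P (s : 'I_l) := r <= s <= i.
apply: leq_trans (lr_tableau_card_cols (P := P) lrT (ltn0Sn r) _ _ _); last 3 first.
- by rewrite -ltnS.
- by move=> s /andP[_]; apply: youngP.
- by move=> s /andP[+ _]; apply: youngP.
apply/subset_leq_card/subsetP=> y; rewrite !inE ltnS => /andP[yi /eqP Ty].
by have := lr_tableau_row_ge y lrT; rewrite /P Ty ltnS => ->; rewrite yi eqxx.
Qed.

(** Split the letters [j.+1] below row [i + j]. The upper ones are at most as many as the letters 1
    in rows up to [i], which avoid the first [lam i] columns; the lower ones lie in the first [h]
    columns. *)
Lemma lr_row_add_le l k (lam mu nu : young l k) (i j : 'I_l) h :
  0 < lr_coef lam mu nu -> h <= k -> (forall r : 'I_l, i + j < r -> nu r <= h) ->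
  lam i + mu j <= k + h.
Proof.
case/card_gt0P=> T; rewrite inE => lrT hk nuh.
have lam_k : lam i <= k by rewrite -ltnS.
suff: mu j <= (k - lam i) + (h - 0) by lia.
rewrite -(lr_tableau_content j lrT).
pose low (s : 'I_l) := i + j < s; pose high (s : 'I_l) := s <= i.
have cover : rows_count T j.+1 l <= rows_count T (1 + j) (i.+1 + j)
    + #|[set y : 'I_l * 'I_k | low y.1 && (T y == j.+1 :> nat)]|.
  apply: leq_trans (subset_leq_card _) (leq_card_setU _ _).
  apply/subsetP=> y; rewrite !inE /low add1n addSn ltnS => /andP[_ ->].
  by rewrite !andbT; case: ltnP.
apply: leq_trans cover (leq_add _ _).
  apply: leq_trans (lr_tableau_rows_countD _ lrT _ _) _ => //.
  apply: leq_trans (lr_tableau_card_cols (v := 1) (P := high) lrT isT (leqnn k) _ _).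
  - by apply/subset_leq_card/subsetP=> y; rewrite !inE ltnS.
  - by move=> s; apply: youngP.
  - by move=> s _; rewrite -ltnS.
by apply: lr_tableau_card_cols lrT _ hk _ nuh.
Qed.

(** * Necessity: rectangles forced into a product *)

Definition contains_rect l k (a A : nat) (p : young l k) : Prop :=
  forall i : 'I_l, i < a -> A <= p i.

Lemma contains_rectP l k (a : 'I_l.+1) (A : 'I_k.+1) (p : young l k) :
  young_sub (rect a A) p -> contains_rect a A p.
Proof. by move/forallP=> sub i ia; have := sub i; rewrite ffunE ia. Qed.

Lemma lr_contains_l l k (lam mu nu : young l k) a A :
  0 < lr_coef lam mu nu -> contains_rect a A lam -> contains_rect a A nu.
Proof.
case/card_gt0P=> T; rewrite inE => /and5P[/forallP sub _ _ _ _] cl i ia.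
exact: leq_trans (cl i ia) (sub i).
Qed.

(** This is the row inequality with [i] the last row, so that [r = j]. *)
Lemma lr_contains_r l k (lam mu nu : young l k) b B :
  0 < lr_coef lam mu nu -> contains_rect b B mu -> contains_rect b B nu.
Proof.
case: l lam mu nu => [|l] lam mu nu lr0 cm j jb; first by case: j jb.
have := lr_row_ge_add (i := ord_max) (j := j) (r := j) lr0.
by move/(_ ltac:(rewrite /=; lia)); have := cm j jb; lia.
Qed.

Lemma lr_contains_meet l k (lam mu nu : young l k) a A b B :
  0 < lr_coef lam mu nu -> contains_rect a A lam -> contains_rect b B mu ->
  a <= l -> b <= l -> contains_rect (a + b - l) (A + B) nu.
Proof.
move=> lr0 cl cm al bl r rab.
have ia : a.-1 < l by lia.
have jb : l + r - a < l by lia.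
have := lr_row_ge_add (i := Ordinal ia) (j := Ordinal jb) (r := r) lr0.
move/(_ ltac:(rewrite /=; lia)); apply: leq_trans; apply: leq_add.
  by apply: cl => /=; lia.
by apply: cm => /=; lia.
Qed.

Lemma lr_contains_join l k (lam mu nu : young l k) a A b B :
  0 < lr_coef lam mu nu -> contains_rect a A lam -> contains_rect b B mu ->
  0 < a <= l -> 0 < b <= l -> contains_rect (a + b) (A + B - k) nu.
Proof.
move=> lr0 cl cm al bl r rab.
(* The last rows of the two rectangles have indices with sum [a + b - 2]. Rows beyond that sum are
   at or below row [r], so [nu r] can serve as the bound [h]. *)
have ia : a.-1 < l by lia.
have jb : b.-1 < l by lia.
have rk : nu r <= k by rewrite -ltnS.
have nu_r (s : 'I_l) : Ordinal ia + Ordinal jb < s -> nu s <= nu r.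
  by move=> /= lt_s; apply: youngP; lia.
have := lr_row_add_le lr0 rk nu_r.
have := cl (Ordinal ia) ltac:(rewrite /=; lia).
have := cm (Ordinal jb) ltac:(rewrite /=; lia).
lia.
Qed.

Lemma lr_rect_fit l k (lam mu nu : young l k) a A b B :
  0 < lr_coef lam mu nu -> contains_rect a A lam -> contains_rect b B mu ->
  a <= l -> b <= l -> a + b <= l \/ A + B <= k.
Proof.
move=> lr0 cl cm al bl; case: (leqP (a + b) l) => [|abl]; [by left|right].
have l0 : 0 < l by lia.
apply: (@leq_trans (nu (Ordinal l0))); last by rewrite -ltnS.
by apply: lr_contains_meet lr0 cl cm al bl _ _ => /=; lia.
Qed.

Lemma lr_three_rects l k (lam mu nu rho p : young l k) a A b B c C :
  0 < lr_coef lam mu rho -> 0 < lr_coef rho nu p ->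
  contains_rect a A lam -> contains_rect b B mu -> contains_rect c C nu ->
  a <= l -> b <= l -> c <= l -> A <= k -> B <= k -> C <= k ->
  [/\ a + b <= l \/ A + B <= k, a + c <= l \/ A + C <= k,
      b + c <= l \/ B + C <= k, a + b + c <= l \/ A + B + C <= 2 * k
    & a + b + c <= 2 * l \/ A + B + C <= k].
Proof.
move=> lr1 lr2 cl cm cn al bl cl' Ak Bk Ck.
have ab := lr_rect_fit lr1 cl cm al bl.
have ac := lr_rect_fit lr2 (lr_contains_l lr1 cl) cn al cl'.
have bc := lr_rect_fit lr2 (lr_contains_r lr1 cm) cn bl cl'.
split=> //.
  (* Condition (iv): if [a + b <= l], the join rectangle must fit with [c x C]; otherwise
     [A + B <= k], and [C <= k] suffices. *)
  case: (posnP a) => [a0|a0]; first by lia.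
  case: (posnP b) => [b0|b0]; first by lia.
  have cj := lr_contains_join lr1 cl cm.
  case: ab => [ab|]; last by lia.
  have := lr_rect_fit lr2 (cj _ _) cn ab cl'; lia.
(* Condition (v): if [a + b > l], the meet rectangle must fit with [c x C]; otherwise [c <= l]
   suffices. *)
case: (leqP (a + b) l) => [|abl]; first by lia.
have := lr_rect_fit lr2 (lr_contains_meet lr1 cl cm al bl) cn _ cl'; lia.
Qed.

(** * Sufficiency: construction of tableaux *)

Lemma lt_find_iota (g : nat -> nat) l j m :
  {homo g : p q / p <= q} -> m < l ->
  (m < find (fun p => j < g p) (iota 0 l)) = (g m <= j).
Proof.
move=> g_mono ml; case: (ltnP m) => [lt_m|le_m].
  by have := before_find 0 lt_m; rewrite nth_iota // add0n => /negbT; rewrite -leqNgt.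
apply/esym/negbTE; rewrite -ltnNge; set n := find _ _ in le_m.
have nl : n < l := leq_ltn_trans le_m ml.
have := @nth_find _ 0 (fun p => j < g p) (iota 0 l).
rewrite has_find size_iota -/n nl nth_iota // add0n => /(_ isT) jn.
exact: leq_trans jn (g_mono _ _ le_m).
Qed.

Lemma rows_countS l k (T : {ffun 'I_l * 'I_k -> 'I_l.+1}) v (r : 'I_l) :
  rows_count T v r.+1 = rows_count T v r + #|[set c | T (r, c) == v :> nat]|.
Proof.
rewrite /rows_count -[X in _ + X](card_imset _ (f := pair r)); last by move=> c c' [].
rewrite -cardsUI [X in _ = _ + X]eq_card0 ?addn0 => [|y]; last first.
  rewrite !inE; apply/negbTE/negP=> /andP[/andP[lt_yr _]] /imsetP[c _ yE].
  by rewrite yE /= ltnn in lt_yr.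
apply: eq_card => -[i c]; rewrite !inE /= ltnS leq_eqVlt andb_orl orbC; congr orb.
apply/andP/imsetP=> [[/eqP/ord_inj-> Ty]|[c']]; first by exists c; rewrite ?inE.
by rewrite inE => Ty [-> ->].
Qed.

(* [G m i] is the number of columns of row [i] filled by [lam] and by the
   letters up to [m], and [S m i] the number of letters [m.+1] in the rows
   above row [i]. *)
Lemma lr_coef_gt0 l k (lam mu nu : young l k) (G S : nat -> nat -> nat) :
  (forall i : 'I_l, G 0 i = lam i) -> (forall i : 'I_l, G l i = nu i) ->
  (forall m i, G m i <= G m.+1 i) -> (forall m i, G m.+1 i.+1 <= G m i) ->
  (forall m, S m 0 = 0) ->
  (forall m i, S m i.+1 = S m i + (G m.+1 i - G m i)) ->
  (forall m i, S m.+1 i.+1 <= S m i) ->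
  (forall m : 'I_l, S m l = mu m) ->
  0 < lr_coef lam mu nu.
Proof.
move=> G0 Gl GS Gdiag S0 SS Sdiag Sl.
have G_mono i : {homo G^~ i : p q / p <= q} by apply: homo_leq => //; apply: leq_trans.
have G_anti m : {homo G m : i j / j <= i >-> i <= j}.
  move=> i j; elim: i => [|i IH]; first by rewrite leqn0 => /eqP->.
  rewrite leq_eqVlt => /predU1P[->//|/IH]; apply: leq_trans.
  exact: leq_trans (GS _ _) (Gdiag _ _).
(* The letter is the least [p] with [y.2 < G p y.1]. If the search below [l] fails, [find] returns
   [l], which is right because [G l] is [nu]. *)
pose letter (y : 'I_l * 'I_k) := if skew_box lam nu y
  then find (fun m => y.2 < G m y.1) (iota 0 l) else 0.
have letter_le y : letter y < l.+1.
  rewrite ltnS /letter; case: ifP => // _.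
  by rewrite (leq_trans (find_size _ _)) ?size_iota.
pose T := [ffun y => Ordinal (letter_le y)].
have TE y m : m < l -> (T y == m.+1 :> nat) = (G m y.1 <= y.2 < G m.+1 y.1).
  move=> ml; rewrite ffunE /= /letter /skew_box -G0 -Gl.
  case: ifPn => [/andP[lo hi]|out]; last first.
    apply/esym/negbTE; apply: contra out => /andP[lo hi].
    by rewrite (leq_trans (G_mono _ _ _ _) lo) ?(leq_trans hi) ?G_mono.
  rewrite eqn_leq andbC lt_find_iota //; congr andb.
  case: (ltnP m.+1 l) => [ml'|lm]; first by rewrite leqNgt lt_find_iota // -ltnNge.
  have -> : m.+1 = l by apply/eqP; rewrite eqn_leq ml lm.
  by rewrite hi (leq_trans (find_size _ _)) ?size_iota.
have Tgt0 y : (0 < T y) = skew_box lam nu y.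
  rewrite ffunE /= /letter; case: ifP => // /andP[lo _].
  by rewrite lt_find_iota ?G0 // (leq_ltn_trans _ (ltn_ord y.1)).
have Tbox y : skew_box lam nu y -> exists2 m, m < l & T y = m.+1 :> nat.
  rewrite -Tgt0; case Ty: (T y : nat) => [//|m] _; exists m => //.
  by rewrite -ltnS -Ty.
have countE m i : m < l -> i <= l -> rows_count T m.+1 i = S m i.
  move=> ml; elim: i => [|i IH] il.
    by rewrite S0; apply: eq_card0 => y; rewrite inE.
  rewrite SS (rows_countS T m.+1 (Ordinal il)) IH 1?ltnW //; congr addn.
  have hi : G m.+1 i <= k.
    by rewrite (leq_trans (G_mono _ _ _ ml)) // (Gl (Ordinal il)) -ltnS.
  rewrite -(card_ord_interval _ hi); apply: eq_card => c.
  by rewrite !inE TE.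
apply/card_gt0P; exists T; rewrite inE /lr_tableau; apply/and5P; split.
- by apply/forallP=> i; rewrite -G0 -Gl G_mono.
- by apply/forallP=> y; rewrite Tgt0.
- apply/forallP=> -[i c]; apply/forallP=> -[i' c']; apply/implyP.
  case/and4P=> /Tbox[m ml /eqP Ty] /Tbox[m' ml' /eqP Ty'] /= /eqP ii cc; subst i'.
  move: (Ty) (Ty'); rewrite !TE //= => /andP[lo hi] /andP[lo' hi'].
  rewrite (eqP Ty) (eqP Ty') ltnS leqNgt; apply/negP=> /(G_mono i) GG.
  by have := leq_trans hi' (leq_trans GG (leq_trans lo cc)); rewrite ltnn.
- apply/forallP=> -[i c]; apply/forallP=> -[i' c']; apply/implyP.
  case/and4P=> /Tbox[m ml /eqP Ty] /Tbox[m' ml' /eqP Ty'] /= /eqP cc ii; subst c'.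
  move: (Ty) (Ty'); rewrite !TE //= => /andP[lo hi] /andP[lo' hi'].
  rewrite (eqP Ty) (eqP Ty') ltnS ltnNge; apply/negP=> mm.
  (* By [Gdiag], the letters up to [m.+1] in the lower row [i'] stop before column [c]. *)
  have := leq_trans (G_anti _ _ _ ii) (leq_trans (Gdiag _ _) lo).
  move/(leq_trans (G_mono i' _ _ (mm : m'.+1 <= m.+1)))/(leq_trans hi').
  by rewrite ltnn.
apply/andP; split.
  apply/forallP=> m; apply/eqP; rewrite -Sl -countE //.
  by apply: eq_card => y; rewrite !inE ltn_ord.
apply/forallP=> -[i c]; apply/forallP=> -[[//|m] ml]; apply/implyP=> _ /=.
(* Count the larger letter through the end of row [i] and the smaller one only above row [i];
   [Sdiag] compares the two. *)
apply: (@leq_trans (rows_count T m.+2 i.+1)).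
  apply/subset_leq_card/subsetP=> -[i' c']; rewrite !inE /read_upto /= => /andP[+ ->].
  by rewrite andbT ltnS => /orP[/ltnW //|/andP[/eqP->]].
apply: (@leq_trans (rows_count T m.+1 i)).
  by rewrite !countE // ltnW.
by apply/subset_leq_card/subsetP=> -[i' c']; rewrite !inE /read_upto /= => /andP[-> ->].
Qed.

Lemma young_exists l k (f : nat -> nat) :
  (forall i, f i.+1 <= f i) -> f 0 <= k ->
  exists p : young l k, forall i : 'I_l, p i = f i :> nat.
Proof.
move=> fS f0k.
have f_anti i j : i <= j -> f j <= f i.
  by move=> ij; rewrite -(subnK ij); elim: (j - i) => //= d; apply: leq_trans; apply: fS.
have f_lt i : f i < k.+1 by rewrite ltnS (leq_trans (f_anti 0 i _)).
have yf : is_young [ffun i : 'I_l => Ordinal (f_lt i)].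
  apply/forallP=> i; apply/forallP=> j; apply/implyP=> ij.
  by rewrite !ffunE f_anti.
by exists (Young yf) => i; rewrite /= ffunE.
Qed.

(* The shape obtained from [lam] by adding [c] boxes to each of its [C] last
   columns and sorting the columns. *)
Lemma lr_rect_last_cols l k (lam : young l k) f (c : 'I_l.+1) (C : 'I_k.+1) :
  (forall i, f i.+1 <= f i) -> f 0 <= k -> (forall i : 'I_l, lam i = f i :> nat) ->
  (0 < c -> f (l - c) <= k - C) ->
  exists nu : young l k, 0 < lr_coef lam (rect c C) nu /\
    forall i : 'I_l,
      nu i = minn (f i) (k - C) + (if i < c then C : nat else f (i - c) - (k - C)) :> nat.
Proof.
move=> fS f0k lamE flc; have cl : c <= l := ltn_ord c; have Ck := ltn_ord C.
have f_anti i j : i <= j -> f j <= f i.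
  by move=> ij; rewrite -(subnK ij); elim: (j - i) => //= d; apply: leq_trans; apply: fS.
(* [F i p] is the length of row [i] within the last [C] columns once each of them has received [p]
   boxes. *)
pose F i p := if i < p then C : nat else f (i - p) - (k - C).
have FSS i p : F i.+1 p.+1 = F i p by rewrite /F ltnS subSS.
have F_le i p : F i p <= C.
  by rewrite /F; case: ifP => // _; have := f_anti 0 (i - p) (leq0n _); lia.
have FrS i p : F i p <= F i p.+1.
  rewrite /F; case: (ltnP i p) => [ip|pi]; first by rewrite ltnS (ltnW ip).
  case: ifP => _; last by apply: leq_sub2r; apply: f_anti; lia.
  by have := f_anti 0 (i - p) (leq0n _); lia.
have FlS i p : F i.+1 p <= F i p.
  by case: p => [|p]; [apply: leq_sub2r; rewrite !subn0 | rewrite FSS].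
have [||nu nuE] := @young_exists l k (fun i => minn (f i) (k - C) + F i c).
- by move=> i; apply: leq_add => //; have := fS i; lia.
- by have := F_le 0 c; lia.
exists nu; split=> //.
pose G m i := minn (f i) (k - C) + F i (minn m c).
(* The sum of [F i' m.+1 - F i' m] over [i' < i] telescopes, as [F i' m = F i'.+1 m.+1]. *)
pose S m i := if m < c then C - F i m.+1 else 0.
apply: (@lr_coef_gt0 _ _ _ _ _ G S) => [i|i|m i|m i|m|m i|m i|m]; rewrite /G /S.
- by rewrite lamE min0n /F ltn0 subn0; lia.
- by rewrite nuE (minn_idPr cl).
- case: (ltnP m c) => mc; last by rewrite (minn_idPr (leqW mc)).
  by rewrite (minn_idPl mc) leq_add2l.
- have fi := fS i; case: (ltnP m c) => mc; last first.
    by rewrite (minn_idPr (leqW mc)); have := FlS i c; lia.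
  by rewrite (minn_idPl mc) FSS; lia.
- by case: ifP => // _; rewrite subnn.
- case: (ltnP m c) => mc; last by rewrite (minn_idPr (leqW mc)); lia.
  rewrite (minn_idPl mc) FSS.
  by have := FrS i m; have := F_le i m.+1; lia.
- by case: ifP => // mc; rewrite FSS (ltnW mc).
- rewrite ffunE; case: ifP => //= mc; rewrite /F ifN; last by lia.
  have := f_anti (l - c) (l - m.+1) ltac:(lia); have := flc ltac:(lia); lia.
Qed.

Lemma lr_rect_rect_rows l k (a b : 'I_l.+1) (A B : 'I_k.+1) t :
  t <= a -> t <= b -> a + b - t <= l -> t = 0 \/ A + B <= k ->
  exists nu : young l k, 0 < lr_coef (rect a A) (rect b B) nu /\
    forall i : 'I_l, nu i <= if i < t then A + B
                             else if i < minn a b then maxn A B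
                             else k.
Proof.
move=> ta tb abl tAB.
have al := ltn_ord a; have bl := ltn_ord b; have Ak := ltn_ord A; have Bk := ltn_ord B.
(* The sorted rows: [t] of length [A + B], [a - t] of length [A] and [b - t] of length [B]. *)
pose r i := if i < t then A + B else if i < minn a b then maxn A B
            else if i < a then A : nat else if i < b then B : nat
            else if i < a + b - t then minn A B else 0.
have [||nu nuE] := @young_exists l k r.
- by move=> i; rewrite /r; repeat (case: ifP => ?; try lia).
- by rewrite /r; repeat (case: ifP => ?; try lia).
exists nu; split=> [|i]; last first.
  by have := ltn_ord (nu i); rewrite nuE /r; repeat (case: ifP => ?; try lia).
pose G p i := let q := minn p b in
  if i < q then r i
  else if i < a then A : nat else if q + a <= t + i then 0 else minn A B.
(* For [p < t] all [B] letters [p.+1] lie in row [p]. For [t <= p < b], row [p] gets [B - minn A B]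
   of them and row [p + a - t] the other [minn A B]. *)
pose S p i := if b <= p then 0 else if p < t then (if p < i then B : nat else 0)
  else (if p < i then B - minn A B else 0) + (if p + a - t < i then minn A B else 0).
apply: (@lr_coef_gt0 _ _ _ _ _ G S) => [i|i|m i|m i|m|m i|m i|m];
  rewrite ?ffunE ?nuE /G /S /r /=.
all: by repeat (case: ifP => ?; try lia).
Qed.

Lemma young_extend l k (p : young l k) :
  exists f : nat -> nat,
    [/\ forall i, f i.+1 <= f i, f 0 <= k & forall i : 'I_l, p i = f i :> nat].
Proof.
exists (fun i => if insub i is Some j then p j : nat else 0); split=> [i||i].
- case: insubP => [j _ /= ji|//]; case: insubP => [j' _ /= j'i|].
    by apply: youngP; lia.
  by have := ltn_ord j; lia.
- by case: insubP => // j _ _; rewrite -ltnS.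
by rewrite valK.
Qed.

Lemma lr_rect_r_gt0 l k (lam : young l k) (c : 'I_l.+1) (C : 'I_k.+1) :
  (forall i : 'I_l, l - c <= i -> lam i <= k - C) ->
  exists nu : young l k, 0 < lr_coef lam (rect c C) nu.
Proof.
move=> lam_c; have [f [fS f0 lamE]] := young_extend lam.
have [c0|nu [nu0 _]] := @lr_rect_last_cols _ _ lam f c C fS f0 lamE; last by exists nu.
have lt_l : l - c < l by have := ltn_ord c; lia.
by have := lam_c (Ordinal lt_l) (leqnn _); rewrite lamE.
Qed.

Theorem theorem1p3 (l k : nat) (hl : 1 <= l) (hk : 1 <= k)
    (a b c : 'I_l.+1) (A B C : 'I_k.+1) :
  ((exists lam mu nu : young l k,
      [/\ young_sub (rect a A) lam,
          young_sub (rect b B) mu,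
          young_sub (rect c C) nu
        & cup (cup (schubert lam) (schubert mu)) (schubert nu) <> 0%R])
   <->
   cup (cup (schubert (rect a A)) (schubert (rect b B))) (schubert (rect c C))
     <> 0%R)
  /\
  (cup (cup (schubert (rect a A)) (schubert (rect b B))) (schubert (rect c C))
     <> 0%R
   <->
   [/\ a + b <= l \/ A + B <= k,
       a + c <= l \/ A + C <= k,
       b + c <= l \/ B + C <= k,
       a + b + c <= l \/ A + B + C <= 2 * k
     & a + b + c <= 2 * l \/ A + B + C <= k]).
Proof.
have refl_sub (p : young l k) : young_sub p p by apply/forallP.
have al := ltn_ord a; have bl := ltn_ord b; have cl := ltn_ord c.
have Ak := ltn_ord A; have Bk := ltn_ord B; have Ck := ltn_ord C.
have fit (lam mu nu : young l k) :
    young_sub (rect a A) lam -> young_sub (rect b B) mu -> young_sub (rect c C) nu ->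
    cup (cup (schubert lam) (schubert mu)) (schubert nu) <> 0%R ->
    [/\ a + b <= l \/ A + B <= k, a + c <= l \/ A + C <= k,
        b + c <= l \/ B + C <= k, a + b + c <= l \/ A + B + C <= 2 * k
      & a + b + c <= 2 * l \/ A + B + C <= k].
  move=> /contains_rectP cl' /contains_rectP cm /contains_rectP cn.
  move=> /cup3_neq0P[rho [p [lr1 lr2]]].
  exact: lr_three_rects lr1 lr2 cl' cm cn _ _ _ _ _ _.
have nonzero : [/\ a + b <= l \/ A + B <= k, a + c <= l \/ A + C <= k,
        b + c <= l \/ B + C <= k, a + b + c <= l \/ A + B + C <= 2 * k
      & a + b + c <= 2 * l \/ A + B + C <= k] ->
    cup (cup (schubert (rect a A)) (schubert (rect b B))) (schubert (rect c C)) <> 0%R.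
  case=> ab ac bc abc abc'; apply/cup3_neq0P.
  suff [rho rho_gt0 rho_c] : exists2 rho : young l k, 0 < lr_coef (rect a A) (rect b B) rho
      & forall i : 'I_l, l - c <= i -> rho i <= k - C.
    by have [p] := lr_rect_r_gt0 rho_c; exists rho, p.
  case: (ltnP (l - c) (minn a b)) => [c_ab|ab_c].
    have [||||rho [rho_gt0 rhoE]] := @lr_rect_rect_rows l k a b A B (a + b - l); try lia.
    have l0 : l - c < l by lia.
    exists rho => // i ci.
    (* Row [l - c] has length at most [A + B] if [a + b + c > 2 * l], where (v) applies, and at most
       [maxn A B] otherwise, where (ii) and (iii) apply. *)
    apply: leq_trans (youngP rho (i := Ordinal l0) ci) (leq_trans (rhoE _) _) => /=.
    by repeat (case: ifP => ?; try lia).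
  pose f i := if i < a then A : nat else 0.
  have [|||b0|rho [rho_gt0 rhoE]] := @lr_rect_last_cols _ _ (rect a A) f b B.
  - by move=> i; rewrite /f; repeat (case: ifP => ?; try lia).
  - by rewrite /f; case: ifP => ?; lia.
  - by move=> i; rewrite ffunE /f; case: ifP.
  - by rewrite /f; case: ifP => ?; lia.
  exists rho => // i ci; rewrite rhoE /f.
  (* As [i >= minn a b], row [i] has length [B] if [i < b], [A] if [b <= i < a], and at most
     [A + B - k] beyond both; (iii), (ii) and (iv) bound these by [k - C]. *)
  by repeat (case: ifP => ?; try lia).
(* [fit] is (I) to (III), [nonzero] is (III) to (II), and the rectangles themselves witness (II) to
   (I). *)
split; split=> //.
- by move=> [lam [mu [nu [sa sb sc nz]]]]; apply/nonzero/(fit _ _ _ sa sb sc nz).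
- by move=> nz; exists (rect a A), (rect b B), (rect c C); split.
- exact: fit.
Qed.
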